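(* Let $n\ge1$, $u\in\mathbb C$ with $u\ne0$, and let $\ddot{\mathfrak H}^{\mathfrak c}$ be the rational double affine Hecke-Clifford algebra with parameter $u$. Let $W$ be a $\mathcal C_n\rtimes\mathbb C S_n$-module, extended to a module over the subalgebra $\mathfrak H^{\mathfrak c}_x$ with each $x_i$ acting by $0$, and identify the induced module $\mathrm{Ind}_{\mathfrak H^{\mathfrak c}_x}^{\ddot{\mathfrak H}^{\mathfrak c}}W$ with $\mathbb C[y_1,\ldots,y_n]\otimes W$ as a vector space. Denote the action by $\circ$. Then for any polynomial $f=f(y_1,\dots,y_n)$, any $w\in W$ and $1\le i\le n$, $$x_i\circ(f\otimes w)=u\sum_{k\neq i}\frac{(1-s_{ki})(f)}{y_i-y_k}\otimes(1-c_ic_k)s_{ki}(w).$$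
   Context: $S_n$ is the symmetric group, $s_{ij}\in S_n$ the transposition of $i$ and $j$. $\mathcal C_n$ is the Clifford algebra over $\mathbb C$ generated by $c_1,\dots,c_n$ with $c_i^2=1$, $c_ic_j=-c_jc_i$ ($i\ne j$), and $\mathcal C_n\rtimes\mathbb C S_n$ is the semidirect product with $\sigma c_i=c_{\sigma(i)}\sigma$. The rational double affine Hecke-Clifford algebra $\ddot{\mathfrak H}^{\mathfrak c}$ with parameter $u\in\mathbb C$ is the associative unital $\mathbb C$-algebra generated by $x_i,y_i,c_i$ ($1\le i\le n$) and $S_n$ (with the relations of the group $S_n$), subject to: $x_ix_j=x_jx_i$, $y_iy_j=y_jy_i$ for all $i,j$; $\sigma x_i=x_{\sigma(i)}\sigma$, $\sigma y_i=y_{\sigma(i)}\sigma$, $\sigma c_i=c_{\sigma(i)}\sigma$ for $\sigma\in S_n$; $c_ix_i=-x_ic_i$, $c_iy_i=y_ic_i$; $c_jx_i=x_ic_j$, $c_jy_i=y_ic_j$ for $i\neq j$; $c_i^2=1$, $c_ic_j=-c_jc_i$ for $i\neq j$; $[y_j,x_i]=u(1+c_jc_i)s_{ij}$ for $i\ne j$; $[y_i,x_i]=-u\sum_{k\neq i}(1+c_kc_i)s_{ki}$. $\mathfrak H^{\mathfrak c}_x$ is the subalgebra of $\ddot{\mathfrak H}^{\mathfrak c}$ generated by $\mathcal C_n\rtimes\mathbb C S_n$ and $x_1,\dots,x_n$. The identification of the induced module $\ddot{\mathfrak H}^{\mathfrak c}\otimes_{\mathfrak H^{\mathfrak c}_x}W$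 with $\mathbb C[y_1,\dots,y_n]\otimes W$ sends $f\otimes w$ ($f\in\mathbb C[y_1,\dots,y_n]$, $w\in W$) to $f\otimes w$ (it is a vector space isomorphism by the PBW property). $S_n$ acts on polynomials in $y_1,\dots,y_n$ by permuting the variables; the quotient $\frac{(1-s_{ki})(f)}{y_i-y_k}$ is a polynomial. *)

(* Defs.v *)
From HB Require Import structures.
From mathcomp Require Import all_boot all_order all_algebra all_fingroup.
From mathcomp Require Import generic_quotient ring_quotient.
From mathcomp Require Import boolp.
From mathcomp.multinomials Require monalg.

Set Implicit Arguments.
Unset Strict Implicit.
Unset Printing Implicit Defensive.

Import GRing.Theory.
Local Open Scope ring_scope.
Local Open Scope quotient_scope.

(* Blocks the unfolding of the quotient constructions below during conversion. *)
Fact quotient_key : unit. Proof. exact: tt. Qed.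

Module PresentedAlgebra.
Import monalg.
Section PresentedAlgebra.
Variables (K : comNzRingType) (G : Type).

Definition free_alg : Type := {malg K[{fmonom {classic G}}]}.
HB.instance Definition _ := GRing.Lalgebra.on free_alg.

Definition free_gen (g : G) : free_alg := mkmalgU (fmu (g : {classic G})) 1.

Variable rel : free_alg -> free_alg -> Prop.

Definition ideal_rel (z : free_alg) : Prop :=
  forall I : free_alg -> Prop,
    (forall a b, rel a b -> I (a - b)) ->
    I 0 -> (forall a b, I a -> I b -> I (a - b)) ->
    (forall a b, I b -> I (a * b)) -> (forall a b, I a -> I (a * b)) ->
  I z.

Definition ideal_pred : {pred free_alg} := fun z => `[< ideal_rel z >].

Lemma ideal_zmod_closed : zmod_closed ideal_pred.
Proof.
split=> [|a b /asboolP Ia /asboolP Ib]; apply/asboolP.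
  by move=> I _ I0.
move=> I Ir I0 IB Il Iri; apply: (IB); [exact: Ia|exact: Ib].
Qed.

HB.instance Definition _ :=
  GRing.isZmodClosed.Build free_alg ideal_pred ideal_zmod_closed.

Lemma ideal_predMl a b : b \in ideal_pred -> a * b \in ideal_pred.
Proof.
move=> /asboolP Ib; apply/asboolP => I Ir I0 IB Il Iri.
by apply: (Il); apply: Ib.
Qed.

Lemma ideal_predMr a b : a \in ideal_pred -> a * b \in ideal_pred.
Proof.
move=> /asboolP Ia; apply/asboolP => I Ir I0 IB Il Iri.
by apply: (Iri); apply: Ia.
Qed.

Lemma ideal_pred_rel a b : rel a b -> a - b \in ideal_pred.
Proof. by move=> rab; apply/asboolP => I Ir *; apply: Ir. Qed.

Definition presented : Type := Quotient.quot ideal_pred.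
HB.instance Definition _ := GRing.Zmodule.on presented.
HB.instance Definition _ := EqQuotient.on presented.

Definition pr (a : free_alg) : presented := \pi_presented a.

Lemma pr_eqP a b : reflect (pr a = pr b) (a - b \in ideal_pred).
Proof. by apply: (iffP idP); rewrite (Quotient.idealrBE ideal_pred) => /eqP. Qed.

Lemma pr_surj (x : presented) : exists a, x = pr a.
Proof. by exists (repr x); rewrite /pr reprK. Qed.

Lemma prD a b : pr (a + b) = pr a + pr b.
Proof. exact: (raddfD (\pi_(Quotient.quot ideal_pred))). Qed.

Definition pmul : presented -> presented -> presented :=
  locked_with quotient_key (fun x y => pr (repr x * repr y)).
Definition pscale : K -> presented -> presented :=
  locked_with quotient_key (fun k x => pr (k *: repr x)).

Lemma repr_pr a : repr (pr a) - a \in ideal_pred.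
Proof. by apply/pr_eqP; rewrite /pr reprK. Qed.

Lemma prM_def a b : pmul (pr a) (pr b) = pr (a * b).
Proof.
rewrite /pmul locked_withE.
apply/pr_eqP; have -> : repr (pr a) * repr (pr b) - a * b =
    (repr (pr a) - a) * repr (pr b) + a * (repr (pr b) - b).
  by rewrite mulrBl mulrBr addrA subrK.
apply: rpredD; [apply: ideal_predMr | apply: ideal_predMl]; exact: repr_pr.
Qed.

Lemma prZ_def k a : pscale k (pr a) = pr (k *: a).
Proof.
rewrite /pscale locked_withE; apply/pr_eqP; rewrite -scalerBr -[_ - _]mul1r scalerAl.
by apply: ideal_predMl; exact: repr_pr.
Qed.

Fact pmulA : associative pmul.
Proof.
move=> x y z; have [[a ->] [b ->] [c ->]] := And3 (pr_surj x) (pr_surj y) (pr_surj z).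
by rewrite !prM_def mulrA.
Qed.
Fact pmul1l : left_id (pr 1) pmul.
Proof. by move=> x; have [a ->] := pr_surj x; rewrite prM_def mul1r. Qed.
Fact pmul1r : right_id (pr 1) pmul.
Proof. by move=> x; have [a ->] := pr_surj x; rewrite prM_def mulr1. Qed.
Fact pmulDl : left_distributive pmul +%R.
Proof.
move=> x y z; have [[a ->] [b ->] [c ->]] := And3 (pr_surj x) (pr_surj y) (pr_surj z).
by rewrite -prD !prM_def mulrDl prD.
Qed.
Fact pmulDr : right_distributive pmul +%R.
Proof.
move=> x y z; have [[a ->] [b ->] [c ->]] := And3 (pr_surj x) (pr_surj y) (pr_surj z).
by rewrite -prD !prM_def mulrDr prD.
Qed.

(* No [algType] here: it would require [1 != 0], which for a presented algebra
   is a theorem about the relations. *)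
HB.instance Definition _ := GRing.Zmodule_isPzRing.Build presented
  pmulA pmul1l pmul1r pmulDl pmulDr.

Fact pscaleA j k x : pscale j (pscale k x) = pscale (j * k) x.
Proof. by have [a ->] := pr_surj x; rewrite !prZ_def scalerA. Qed.
Fact pscale1 : left_id 1 pscale.
Proof. by move=> x; have [a ->] := pr_surj x; rewrite prZ_def scale1r. Qed.
Fact pscaleDr : right_distributive pscale +%R.
Proof.
move=> k x y; have [[a ->] [b ->]] := conj (pr_surj x) (pr_surj y).
by rewrite -prD !prZ_def scalerDr prD.
Qed.
Fact pscaleDl x : {morph pscale^~ x : j k / j + k}.
Proof. by move=> j k; have [a ->] := pr_surj x; rewrite !prZ_def scalerDl prD. Qed.

HB.instance Definition _ := GRing.Zmodule_isLmodule.Build K presented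
  pscaleA pscale1 pscaleDr pscaleDl.

Lemma prM a b : pr (a * b) = pr a * pr b.
Proof. by rewrite -prM_def. Qed.
Lemma pr1 : pr 1 = 1. Proof. by []. Qed.
Lemma prB a b : pr (a - b) = pr a - pr b.
Proof. exact: (raddfB (\pi_(Quotient.quot ideal_pred))). Qed.
Lemma prN a : pr (- a) = - pr a.
Proof. exact: (raddfN (\pi_(Quotient.quot ideal_pred))). Qed.
Lemma pr_sum (I : finType) (P : pred I) (F : I -> free_alg) :
  pr (\sum_(i | P i) F i) = \sum_(i | P i) pr (F i).
Proof. exact: (raddf_sum (\pi_(Quotient.quot ideal_pred))). Qed.
Lemma prZ k a : pr (k *: a) = k *: pr a.
Proof. by rewrite -prZ_def. Qed.

Lemma pr_rel a b : rel a b -> pr a = pr b.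
Proof. by move=> /ideal_pred_rel/pr_eqP. Qed.

Lemma presented_scaleAl k (x y : presented) : k *: (x * y) = (k *: x) * y.
Proof.
have [[a ->] [b ->]] := conj (pr_surj x) (pr_surj y).
by rewrite -prM -!prZ -prM scalerAl.
Qed.

Lemma presented_scaleAr k (x y : presented) : k *: (x * y) = x * (k *: y).
Proof.
have [[a ->] [b ->]] := conj (pr_surj x) (pr_surj y).
rewrite -prM -!prZ -prM; congr pr.
have comm (c : {malg K[{fmonom {classic G}}]}) : malgC k * c = c * malgC k.
  rewrite malgM_def [RHS]malgM_def fgmulUg fgmulgU.
  by apply: eq_bigr => m _; rewrite mul1m mulm1 mulrC.
by rewrite -[LHS]mul_malgC -[k *: b]mul_malgC mulrA comm -mulrA.
Qed.

Definition gen (g : G) : presented :=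
  locked_with quotient_key (pr (free_gen g)).

Lemma genE g : pr (free_gen g) = gen g.
Proof. by rewrite /gen locked_withE. Qed.

Definition scal (k : K) : presented := k *: (1 : presented).

Fact scal_zmod_morphism : zmod_morphism scal.
Proof. by move=> j k; rewrite /scal scalerBl. Qed.
Fact scal_monoid_morphism : monoid_morphism scal.
Proof.
split=> [|j k]; first by rewrite /scal scale1r.
by rewrite /scal -presented_scaleAl mul1r scalerA.
Qed.
HB.instance Definition _ :=
  GRing.isZmodMorphism.Build K presented scal scal_zmod_morphism.
HB.instance Definition _ :=
  GRing.isMonoidMorphism.Build K presented scal scal_monoid_morphism.

Definition in_subalg (S : presented -> Prop) (x : presented) : Prop :=
  forall B : presented -> Prop,
    (forall k, B (scal k)) ->
    (forall a b, B a -> B b -> B (a - b)) ->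
    (forall a b, B a -> B b -> B (a * b)) ->
    (forall a, S a -> B a) ->
  B x.

End PresentedAlgebra.
End PresentedAlgebra.
Export PresentedAlgebra.

Definition subalg (K : comNzRingType) (G : Type)
    (rel : free_alg K G -> free_alg K G -> Prop) (S : presented rel -> Prop) :
  Type := {x : presented rel | `[< in_subalg S x >]}.

Section SubalgebraTheory.
Variables (K : comNzRingType) (G : Type).
Variable rel : free_alg K G -> free_alg K G -> Prop.
Variable S : presented rel -> Prop.

Definition subalg_pred : pred (presented rel) := fun x => `[< in_subalg S x >].

Fact subalg_subring_closed : subring_closed subalg_pred.
Proof.
split=> [|x y /asboolP Bx /asboolP By|x y /asboolP Bx /asboolP By];
  apply/asboolP => B Bk BB BM BS.
- by rewrite -[1]scale1r; apply: Bk.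
- by apply: (BB); [apply: Bx | apply: By].
- by apply: (BM); [apply: Bx | apply: By].
Qed.

HB.instance Definition _ := SubChoice.copy (subalg S) {x | subalg_pred x}.
HB.instance Definition _ := GRing.SubChoice_isSubPzRing.Build
  (presented rel) subalg_pred (subalg S) subalg_subring_closed.

Fact scal_in_subalg k : subalg_pred (scal rel k).
Proof. by apply/asboolP => B Bk *; apply: Bk. Qed.
Definition sub_scal k : subalg S := Sub (scal rel k) (scal_in_subalg k).

Fact gen_in_subalg x : S x -> subalg_pred x.
Proof. by move=> Sx; apply/asboolP => B ? ? ? BS; apply: BS. Qed.
Definition sub_gen x (Sx : S x) : subalg S := Sub x (gen_in_subalg Sx).

Definition subalg_val : subalg S -> presented rel := val.
HB.instance Definition _ :=
  GRing.RMorphism.copy subalg_val (val : subalg S -> presented rel).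

End SubalgebraTheory.

Definition restrict (S T : pzRingType) (j : {rmorphism S -> T}) (W : lmodType T) :
  Type := W.

Section Restrict.
Variables (S T : pzRingType) (j : {rmorphism S -> T}) (W : lmodType T).

HB.instance Definition _ := GRing.Zmodule.on (restrict j W).

Definition restrict_scale (s : S) (w : restrict j W) : restrict j W :=
  j s *: (w : W).
Fact restrict_scaleA a b w :
  restrict_scale a (restrict_scale b w) = restrict_scale (a * b) w.
Proof. by rewrite /restrict_scale scalerA rmorphM. Qed.
Fact restrict_scale1 : left_id 1 restrict_scale.
Proof. by move=> w; rewrite /restrict_scale rmorph1 scale1r. Qed.
Fact restrict_scaleDr : right_distributive restrict_scale +%R.
Proof. by move=> s w w'; rewrite /restrict_scale scalerDr. Qed.
Fact restrict_scaleDl w : {morph restrict_scale^~ w : a b / a + b}.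
Proof. by move=> a b; rewrite /restrict_scale rmorphD scalerDl. Qed.

HB.instance Definition _ := GRing.Zmodule_isLmodule.Build S (restrict j W)
  restrict_scaleA restrict_scale1 restrict_scaleDr restrict_scaleDl.

End Restrict.

From mathcomp.multinomials Require Import freeg.

Module Tensor.
Section TensorProduct.
Variables (S T : pzRingType) (j : {rmorphism S -> T}) (W : lmodType S).

Definition free_pairs : Type := {freeg (T * W)%type / int}.
HB.instance Definition _ := GRing.Zmodule.on free_pairs.

Definition free_pair (t : T) (w : W) : free_pairs := << (t, w) >>.

Definition balanced_rel (z : free_pairs) : Prop :=
  forall I : free_pairs -> Prop,
    I 0 -> (forall a b, I a -> I b -> I (a - b)) ->
    (forall t t' w,
       I (free_pair (t + t') w - (free_pair t w + free_pair t' w))) ->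
    (forall t w w',
       I (free_pair t (w + w') - (free_pair t w + free_pair t w'))) ->
    (forall t s w, I (free_pair (t * j s) w - free_pair t (s *: w))) ->
  I z.

Definition balanced_pred : {pred free_pairs} := fun z => `[< balanced_rel z >].

Fact balanced_zmod_closed : zmod_closed balanced_pred.
Proof.
split=> [|a b /asboolP Ia /asboolP Ib]; apply/asboolP.
  by move=> I I0.
by move=> I I0 IB *; apply: (IB); [apply: Ia | apply: Ib].
Qed.
HB.instance Definition _ :=
  GRing.isZmodClosed.Build free_pairs balanced_pred balanced_zmod_closed.

(* T ⊗_S W, where S acts on T on the right through j. *)
Definition tensor : Type := Quotient.quot balanced_pred.
HB.instance Definition _ := GRing.Zmodule.on tensor.
HB.instance Definition _ := EqQuotient.on tensor.

Definition tpi (z : free_pairs) : tensor := \pi_tensor z.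
Definition tens (t : T) (w : W) : tensor :=
  locked_with quotient_key (tpi (free_pair t w)).

Lemma tensE t w : tens t w = tpi (free_pair t w).
Proof. by rewrite /tens locked_withE. Qed.

Lemma tpi_eqP a b : reflect (tpi a = tpi b) (a - b \in balanced_pred).
Proof. by apply: (iffP idP); rewrite (Quotient.idealrBE balanced_pred) => /eqP. Qed.

Lemma tpiB a b : tpi (a - b) = tpi a - tpi b.
Proof. exact: (raddfB (\pi_(Quotient.quot balanced_pred))). Qed.

Lemma tpiD a b : tpi (a + b) = tpi a + tpi b.
Proof. exact: (raddfD (\pi_(Quotient.quot balanced_pred))). Qed.

Lemma tensDl t t' w : tens (t + t') w = tens t w + tens t' w.
Proof.
rewrite !tensE -tpiD; apply/tpi_eqP/asboolP => I ? ? IDl *; exact: IDl.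
Qed.

Lemma tensDr t w w' : tens t (w + w') = tens t w + tens t w'.
Proof.
rewrite !tensE -tpiD; apply/tpi_eqP/asboolP => I ? ? ? IDr *; exact: IDr.
Qed.

Lemma tens_balanced t s w : tens (t * j s) w = tens t (s *: w).
Proof. by rewrite !tensE; apply/tpi_eqP/asboolP => I ? ? ? ? IM; apply: IM. Qed.

Lemma tens_ind (P : tensor -> Prop) :
  P 0 -> (forall x y, P x -> P y -> P (x - y)) -> (forall t w, P (tens t w)) ->
  forall x, P x.
Proof.
move=> P0 PB Pt x; rewrite -[x]reprK.
have PN y : P y -> P (- y) by move=> Py; rewrite -sub0r; apply: PB.
have PD y z : P y -> P z -> P (y + z).
  by move=> Py Pz; rewrite -[z]opprK; apply: PB => //; apply: PN.
rewrite -[repr x]freeg_sumE.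
elim/big_rec: _ => [|[t w] y _ Py].
  suff -> : \pi_tensor 0 = 0 by [].
  exact: (raddf0 (\pi_(Quotient.quot balanced_pred))).
rewrite -/(tpi _) tpiD; apply: (PD) => //.
set k := coeff _ _.
have tpiM (m : nat) : P (tpi << m%:Z *g (t, w) >>).
  elim: m => [|m IHm]; first by rewrite freegU0 -[0](subrr 0) tpiB subrr.
  by rewrite -addn1 PoszD -freegUD tpiD; apply: PD => //; rewrite -tensE; apply: Pt.
case: k => m //.
by rewrite NegzE -freegUN -sub0r tpiB -[0](subrr 0) tpiB subrr; apply: PB.
Qed.

Section Lift.
Variables (M : zmodType) (b : T -> W -> M).

Definition lift_pair (p : (T * W)%type) : zmodule M := b p.1 p.2.
Definition tens_lift : tensor -> M :=
  locked_with quotient_key (fun x => fglift lift_pair (repr x)).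

Hypothesis bDl : forall t t' w, b (t + t') w = b t w + b t' w.
Hypothesis bDr : forall t w w', b t (w + w') = b t w + b t w'.
Hypothesis b_balanced : forall t s w, b (t * j s) w = b t (s *: w).

Let lB (x y : free_pairs) :
  fglift lift_pair (x - y) = fglift lift_pair x - fglift lift_pair y :> M.
Proof.
exact: (@lift_is_additive int (T * W)%type (zmodule M) lift_pair x y).
Qed.

Let l0 : fglift lift_pair 0 = 0 :> M.
Proof. by have := lB 0 0; rewrite !subrr. Qed.

Let lD (x y : free_pairs) :
  fglift lift_pair (x + y) = fglift lift_pair x + fglift lift_pair y :> M.
Proof.
by rewrite -[y in LHS]opprK lB -sub0r lB l0 sub0r opprK.
Qed.

Let lU t w : fglift lift_pair (free_pair t w) = b t w.
Proof. by rewrite /free_pair liftU scale1r. Qed.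

Let l_balanced (z : free_pairs) : z \in balanced_pred -> fglift lift_pair z = 0 :> M.
Proof.
move=> /asboolP/(_ (fun x => fglift lift_pair x = 0 :> M)); apply=> [|x y x0 y0|t t' w|t w w'|t s w].
- exact: l0.
- by rewrite lB x0 y0 subrr.
- by rewrite lB lD !lU bDl subrr.
- by rewrite lB lD !lU bDr subrr.
- by rewrite lB !lU b_balanced subrr.
Qed.

Let lpi z : tens_lift (tpi z) = fglift lift_pair z.
Proof.
rewrite /tens_lift locked_withE.
apply/eqP; rewrite -subr_eq0 -lB; apply/eqP/l_balanced.
by apply/tpi_eqP; rewrite /tpi reprK.
Qed.

Lemma tens_liftE t w : tens_lift (tens t w) = b t w.
Proof. by rewrite tensE lpi lU. Qed.

Lemma tens_lift_zmod_morphism : zmod_morphism tens_lift.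
Proof.
move=> x y; rewrite -[x]reprK -[y]reprK -!/(tpi _) -tpiB !lpi.
exact: lB.
Qed.

End Lift.

Definition tens_scale (h : T) : tensor -> tensor :=
  tens_lift (fun t w => tens (h * t) w).

Fact tens_scaleE h t w : tens_scale h (tens t w) = tens (h * t) w.
Proof.
rewrite /tens_scale tens_liftE => // *; rewrite ?mulrDr ?tensDl ?tensDr //.
by rewrite mulrA tens_balanced.
Qed.

Fact tens_scaleB h : zmod_morphism (tens_scale h).
Proof.
apply: tens_lift_zmod_morphism => *; rewrite ?mulrDr ?tensDl ?tensDr //.
by rewrite mulrA tens_balanced.
Qed.

Fact tens_scale0 h : tens_scale h 0 = 0.
Proof. by rewrite -[0 in LHS](subrr 0) tens_scaleB subrr. Qed.

Fact tens_scaleA a b x : tens_scale a (tens_scale b x) = tens_scale (a * b) x.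
Proof.
elim/tens_ind: x => [|x y IHx IHy|t w]; first by rewrite !tens_scale0.
  by rewrite !tens_scaleB IHx IHy.
by rewrite !tens_scaleE mulrA.
Qed.

Fact tens_scale1 : left_id 1 tens_scale.
Proof.
elim/tens_ind => [|x y IHx IHy|t w]; first by rewrite tens_scale0.
  by rewrite tens_scaleB IHx IHy.
by rewrite tens_scaleE mul1r.
Qed.

Fact tens_scaleDr : right_distributive tens_scale +%R.
Proof.
move=> h x y.
have N z : tens_scale h (- z) = - tens_scale h z.
  by rewrite -sub0r tens_scaleB tens_scale0 sub0r.
by rewrite -{1}[y]opprK tens_scaleB N opprK.
Qed.

Fact tens_scaleDl x : {morph tens_scale^~ x : a b / a + b}.
Proof.
move=> a b; elim/tens_ind: x => [|x y IHx IHy|t w].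
- by rewrite !tens_scale0 addr0.
- by rewrite !tens_scaleB IHx IHy opprD addrACA.
- by rewrite !tens_scaleE mulrDl tensDl.
Qed.

HB.instance Definition _ := GRing.Zmodule_isLmodule.Build T tensor
  tens_scaleA tens_scale1 tens_scaleDr tens_scaleDl.

Lemma scale_tens h t w : h *: tens t w = tens (h * t) w.
Proof. exact: tens_scaleE. Qed.

End TensorProduct.
End Tensor.
Export Tensor.

Inductive cs_generator (n : nat) := CS_c of 'I_n | CS_s of 'S_n.

Inductive dahca_generator (n : nat) :=
  D_x of 'I_n | D_y of 'I_n | D_c of 'I_n | D_s of 'S_n.


(* MathComp composes permutations from left to right: [(t * s)%g] is the map
   [i |-> s (t i)], that is the product σ τ of the symmetric group acting on the
   left, as required by σ c_i = c_{σ(i)} σ. *)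
Section CliffordSymmetric.
Variables (K : comNzRingType) (n : nat).

Local Notation c i := (free_gen K (CS_c i)).
Local Notation s σ := (free_gen K (CS_s σ)).

Inductive cs_relation :
    free_alg K (cs_generator n) -> free_alg K (cs_generator n) -> Prop :=
| CS_s1 : cs_relation (s 1%g) 1
| CS_sM (σ τ : 'S_n) : cs_relation (s σ * s τ) (s (τ * σ)%g)
| CS_c2 i : cs_relation (c i ^+ 2) 1
| CS_cc i j : i != j -> cs_relation (c i * c j) (- (c j * c i))
| CS_sc (σ : 'S_n) i : cs_relation (s σ * c i) (c (σ i) * s σ).

Definition clifford_sym : Type := presented cs_relation.
HB.instance Definition _ := GRing.PzRing.on clifford_sym.
HB.instance Definition _ := GRing.Lmodule.on clifford_sym.

Definition cs_c i : clifford_sym := gen cs_relation (CS_c i).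
Definition cs_s (σ : 'S_n) : clifford_sym := gen cs_relation (CS_s σ).

Definition cs_scal : K -> clifford_sym := scal cs_relation.
HB.instance Definition _ :=
  GRing.RMorphism.copy cs_scal (scal cs_relation : K -> presented cs_relation).

Lemma cs_s1 : cs_s 1%g = 1.
Proof. by have := pr_rel CS_s1; rewrite -> genE, pr1. Qed.
Lemma cs_sM (σ τ : 'S_n) : cs_s σ * cs_s τ = cs_s (τ * σ)%g.
Proof. by have := pr_rel (CS_sM σ τ); rewrite -> prM, !genE. Qed.
Lemma cs_c2 i : cs_c i ^+ 2 = 1.
Proof. by have := pr_rel (CS_c2 i); rewrite -> expr2, prM, genE, pr1. Qed.
Lemma cs_cc i j : i != j -> cs_c i * cs_c j = - (cs_c j * cs_c i).
Proof. by move=> /CS_cc/pr_rel; rewrite -> prN, !prM, !genE. Qed.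
Lemma cs_sc (σ : 'S_n) i : cs_s σ * cs_c i = cs_c (σ i) * cs_s σ.
Proof. by have := pr_rel (CS_sc σ i); rewrite -> !prM, !genE. Qed.

End CliffordSymmetric.

Module RationalDAHCA.
Section RationalDAHCA.
Variables (K : comNzRingType) (n : nat) (u : K).

Local Notation x i := (free_gen K (D_x i)).
Local Notation y i := (free_gen K (D_y i)).
Local Notation c i := (free_gen K (D_c i)).
Local Notation s σ := (free_gen K (D_s σ)).

Inductive dahca_relation :
    free_alg K (dahca_generator n) -> free_alg K (dahca_generator n) ->
    Prop :=
| D_s1 : dahca_relation (s 1%g) 1
| D_sM (σ τ : 'S_n) : dahca_relation (s σ * s τ) (s (τ * σ)%g)
| D_xx i j : dahca_relation (x i * x j) (x j * x i)
| D_yy i j : dahca_relation (y i * y j) (y j * y i)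
| D_sx (σ : 'S_n) i : dahca_relation (s σ * x i) (x (σ i) * s σ)
| D_sy (σ : 'S_n) i : dahca_relation (s σ * y i) (y (σ i) * s σ)
| D_sc (σ : 'S_n) i : dahca_relation (s σ * c i) (c (σ i) * s σ)
| D_cx i : dahca_relation (c i * x i) (- (x i * c i))
| D_cy i : dahca_relation (c i * y i) (y i * c i)
| D_cx_neq i j : i != j -> dahca_relation (c j * x i) (x i * c j)
| D_cy_neq i j : i != j -> dahca_relation (c j * y i) (y i * c j)
| D_c2 i : dahca_relation (c i ^+ 2) 1
| D_cc i j : i != j -> dahca_relation (c i * c j) (- (c j * c i))
| D_yx_neq i j : i != j ->
    dahca_relation (y j * x i - x i * y j)
                   (u *: ((1 + c j * c i) * s (tperm i j)))
| D_yx i :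
    dahca_relation (y i * x i - x i * y i)
                   (- (u *: \sum_(k | k != i) (1 + c k * c i) * s (tperm k i))).

Definition dahca : Type := presented dahca_relation.
HB.instance Definition _ := GRing.PzRing.on dahca.
HB.instance Definition _ := GRing.Lmodule.on dahca.

Definition dx i : dahca := gen dahca_relation (D_x i).
Definition dy i : dahca := gen dahca_relation (D_y i).
Definition dc i : dahca := gen dahca_relation (D_c i).
Definition ds (σ : 'S_n) : dahca := gen dahca_relation (D_s σ).

Lemma ds1 : ds 1%g = 1.
Proof. by have := pr_rel D_s1; rewrite -> genE, pr1. Qed.
Lemma dsM (σ τ : 'S_n) : ds σ * ds τ = ds (τ * σ)%g.
Proof. by have := pr_rel (D_sM σ τ); rewrite -> !prM, !genE. Qed.
Lemma dxx i j : dx i * dx j = dx j * dx i.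
Proof. by have := pr_rel (D_xx i j); rewrite -> !prM, !genE. Qed.
Lemma dyy i j : dy i * dy j = dy j * dy i.
Proof. by have := pr_rel (D_yy i j); rewrite -> !prM, !genE. Qed.
Lemma dsx (σ : 'S_n) i : ds σ * dx i = dx (σ i) * ds σ.
Proof. by have := pr_rel (D_sx σ i); rewrite -> !prM, !genE. Qed.
Lemma dsy (σ : 'S_n) i : ds σ * dy i = dy (σ i) * ds σ.
Proof. by have := pr_rel (D_sy σ i); rewrite -> !prM, !genE. Qed.
Lemma dsc (σ : 'S_n) i : ds σ * dc i = dc (σ i) * ds σ.
Proof. by have := pr_rel (D_sc σ i); rewrite -> !prM, !genE. Qed.
Lemma dcx i : dc i * dx i = - (dx i * dc i).
Proof. by have := pr_rel (D_cx i); rewrite -> prN, !prM, !genE. Qed.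
Lemma dcy i : dc i * dy i = dy i * dc i.
Proof. by have := pr_rel (D_cy i); rewrite -> !prM, !genE. Qed.
Lemma dcx_neq i j : i != j -> dc j * dx i = dx i * dc j.
Proof. by move=> /D_cx_neq/pr_rel; rewrite -> !prM, !genE. Qed.
Lemma dcy_neq i j : i != j -> dc j * dy i = dy i * dc j.
Proof. by move=> /D_cy_neq/pr_rel; rewrite -> !prM, !genE. Qed.
Lemma dc2 i : dc i ^+ 2 = 1.
Proof. by have := pr_rel (D_c2 i); rewrite -> expr2, prM, genE, pr1. Qed.
Lemma dcc i j : i != j -> dc i * dc j = - (dc j * dc i).
Proof. by move=> /D_cc/pr_rel; rewrite -> prN, !prM, !genE. Qed.
Lemma dyx_neq i j : i != j ->
  dy j * dx i - dx i * dy j = u *: ((1 + dc j * dc i) * ds (tperm i j)).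
Proof.
by move=> /D_yx_neq/pr_rel; rewrite -> prB, prZ, !prM, prD, prM, pr1, !genE.
Qed.
Lemma dyx i :
  dy i * dx i - dx i * dy i =
  - (u *: \sum_(k | k != i) (1 + dc k * dc i) * ds (tperm k i)).
Proof.
have := pr_rel (D_yx i); rewrite -> prB, prN, prZ, !prM, pr_sum, !genE => ->.
congr (- (u *: _)); apply: eq_bigr => k _.
by rewrite -> prM, prD, prM, pr1, !genE.
Qed.

Inductive dahca_x_generator : dahca -> Prop :=
| Gen_x i : dahca_x_generator (dx i)
| Gen_c i : dahca_x_generator (dc i)
| Gen_s σ : dahca_x_generator (ds σ).

(* The subalgebra 𝔥^c_x generated by 𝒞_n ⋊ KS_n and the x_i. *)
Definition dahca_x : Type :=
  @subalg _ _ dahca_relation dahca_x_generator.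
HB.instance Definition _ := GRing.PzRing.on dahca_x.

Definition xx i : dahca_x := sub_gen (Gen_x i).
Definition xc i : dahca_x := sub_gen (Gen_c i).
Definition xs σ : dahca_x := sub_gen (Gen_s σ).
Definition x_scal k : dahca_x := sub_scal dahca_x_generator k.

Definition dahca_x_val : dahca_x -> dahca :=
  @subalg_val _ _ dahca_relation dahca_x_generator.
HB.instance Definition _ := GRing.RMorphism.copy dahca_x_val
  (@subalg_val _ _ dahca_relation dahca_x_generator).

(* An action of dahca_x on W extending that of 𝒞_n ⋊ KS_n, with x_i acting by 0.
   As both actions are additive and multiplicative, it is enough that they agree
   on scalars and generators. *)
Record zero_extension (W : lmodType (clifford_sym K n)) := ZeroExtension {
  ext_act : dahca_x -> W -> W;
  ext_actA : forall a b w, ext_act a (ext_act b w) = ext_act (a * b) w;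
  ext_act1 : left_id 1 ext_act;
  ext_actDr : right_distributive ext_act +%R;
  ext_actDl : forall w, {morph ext_act^~ w : a b / a + b};
  ext_act_scal : forall k w, ext_act (x_scal k) w = cs_scal n k *: w;
  ext_act_c : forall i w, ext_act (xc i) w = cs_c K i *: w;
  ext_act_s : forall σ w, ext_act (xs σ) w = cs_s K σ *: w;
  ext_act_x : forall i w, ext_act (xx i) w = 0
}.

Definition extended (W : lmodType (clifford_sym K n)) (E : zero_extension W) :
  Type := W.

Section Extended.
Variables (W : lmodType (clifford_sym K n)) (E : zero_extension W).
HB.instance Definition _ := GRing.Zmodule.on (extended E).
HB.instance Definition _ := GRing.Zmodule_isLmodule.Build dahca_x (extended E)
  (ext_actA E) (ext_act1 E) (ext_actDr E) (ext_actDl E).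

Definition ind : Type := tensor dahca_x_val (extended E).
HB.instance Definition _ := GRing.Lmodule.on ind.

Definition ind_tens (h : dahca) (w : W) : ind :=
  tens dahca_x_val h (w : extended E).

Lemma scale_ind_tens h g w : h *: ind_tens g w = ind_tens (h * g) w.
Proof. exact: scale_tens. Qed.

Lemma ind_tens_balanced h a w :
  ind_tens (h * dahca_x_val a) w = ind_tens h (ext_act E a w).
Proof. exact: tens_balanced. Qed.
End Extended.

End RationalDAHCA.
End RationalDAHCA.
Export RationalDAHCA.

From mathcomp.multinomials Require Import mpoly.

Module Induced.
Section DividedDifference.
Variables (K : comNzRingType) (n : nat).
Implicit Types (f g : {mpoly K[n]}) (i k : 'I_n).

Lemma divdiff_exists i k f :
  exists q, q * ('X_i - 'X_k) == f - msym (tperm k i) f.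
Proof.
pose D f := exists q, q * ('X_i - 'X_k) == f - msym (tperm k i) f.
have DD g h : D g -> D h -> D (g + h).
  move=> [q /eqP qP] [r /eqP rP]; exists (q + r); apply/eqP.
  by rewrite mulrDl qP rP msymD opprD addrACA.
have DZ a g : D g -> D (a *: g).
  move=> [q /eqP qP]; exists (a *: q); apply/eqP.
  by rewrite -scalerAl qP msymZ scalerBr.
have DM g h : D g -> D h -> D (g * h).
  move=> [q /eqP qP] [r /eqP rP]; exists (q * h + msym (tperm k i) g * r).
  apply/eqP; rewrite mulrDl mulrAC qP -mulrA rP msymM mulrBl mulrBr.
  by rewrite subrKA.
have D1 : D 1 by exists 0; rewrite mul0r msym1 subrr.
have DX j : D 'X_j.
  have symX : msym (tperm k i) 'X_j = 'X_(tperm k i j) :> {mpoly K[n]}.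
    by rewrite /msym mmapX mmap1U.
  rewrite /D symX; case: tpermP => [->|->|_ _].
  - by exists (-1); rewrite mulN1r opprB.
  - by exists 1; rewrite mul1r.
  - by exists 0; rewrite mul0r subrr.
suff : D f by [].
elim/mpolyind: f => [|a m f _ _ Df]; first by exists 0; rewrite mul0r msym0 subrr.
refine (DD _ _ (DZ _ _ _) Df); rewrite mpolyXE_id.
apply: (big_ind D) => [|g h|j _]; [exact: D1|exact: DM|].
elim: (m j) => [|d IHd]; first by rewrite expr0; exact: D1.
by rewrite exprS; exact: (DM _ _ (DX j) IHd).
Qed.

(* The polynomial (1 - s_{ki})(f) / (y_i - y_k); it is unique when i != k. *)
Definition divdiff i k f : {mpoly K[n]} := xchoose (divdiff_exists i k f).

Lemma divdiffE i k f :
  divdiff i k f * ('X_i - 'X_k) = f - msym (tperm k i) f.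
Proof. exact/eqP/(xchooseP (divdiff_exists i k f)). Qed.

End DividedDifference.

Section Induced.
Variables (K : comNzRingType) (n : nat) (u : K).

Definition eval_y (f : {mpoly K[n]}) : dahca n u :=
  \sum_(m <- msupp f) f@_m *: \prod_(i < n) dy u i ^+ m i.

Lemma eval_yE k (f : {mpoly K[n]}) : (msize f <= k)%N ->
  eval_y f = \sum_(m : 'X_{1..n < k}) f@_m *: \prod_(i < n) dy u i ^+ m i.
Proof.
move=> le_fk; rewrite /eval_y (ssrcomplements.big_mksub 'X_{1..n < k}) //=; first last.
- by move=> m /msize_mdeg_lt /leq_trans; apply.
- by rewrite msupp_uniq.
rewrite big_rmcond //= => m /memN_msupp_eq0 ->.
by rewrite scale0r.
Qed.

Lemma eval_yD : {morph eval_y : f g / f + g}.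
Proof.
move=> f g; pose k := maxn (msize (f + g)) (maxn (msize f) (msize g)).
rewrite !(@eval_yE k) /k ?leq_max ?leqnn ?orbT // -big_split /=.
by apply: eq_bigr => m _; rewrite mcoeffD scalerDl.
Qed.

Lemma eval_yZ a f : eval_y (a *: f) = a *: eval_y f.
Proof.
pose k := maxn (msize (a *: f)) (msize f).
rewrite !(@eval_yE k) /k ?leq_max ?leqnn ?orbT // scaler_sumr.
by apply: eq_bigr => m _; rewrite mcoeffZ scalerA.
Qed.

Variable W : lmodType (clifford_sym K n).

(* K[y_1, ..., y_n] ⊗_K W, as a K-module. *)
Definition poly_tens : Type :=
  restrict (@mpolyC n K)
    (tensor (@mpolyC n K) (restrict (@cs_scal K n) W)).
HB.instance Definition _ := GRing.Lmodule.on poly_tens.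

Definition ytens (f : {mpoly K[n]}) (w : W) : poly_tens :=
  tens (@mpolyC n K) f (w : restrict (@cs_scal K n) W).

Lemma scale_ytens a f w : a *: ytens f w = ytens (a *: f) w.
Proof. by rewrite -mul_mpolyC; exact: scale_tens. Qed.

Variable E : zero_extension u W.

Definition ind_of_poly : poly_tens -> ind E :=
  @tens_lift _ _ (@mpolyC n K) (restrict (@cs_scal K n) W) (ind E)
    (fun f w => ind_tens E (eval_y f) w).

Let bDl f g w :
  ind_tens E (eval_y (f + g)) w = ind_tens E (eval_y f) w + ind_tens E (eval_y g) w.
Proof. by rewrite eval_yD /ind_tens tensDl. Qed.

Let bDr f w w' :
  ind_tens E (eval_y f) (w + w') = ind_tens E (eval_y f) w + ind_tens E (eval_y f) w'.
Proof. exact: tensDr. Qed.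

Let b_balanced f a w :
  ind_tens E (eval_y (f * a%:MP)) w =
  ind_tens E (eval_y f) (a *: (w : restrict (@cs_scal K n) W)).
Proof.
rewrite mulrC mul_mpolyC eval_yZ.
have -> : a *: (w : restrict (@cs_scal K n) W) = ext_act E (x_scal n u a) w.
  by rewrite ext_act_scal.
rewrite -ind_tens_balanced; congr ind_tens.
by rewrite -{1}[eval_y f]mulr1; exact: presented_scaleAr.
Qed.

Lemma ind_of_polyE f w : ind_of_poly (ytens f w) = ind_tens E (eval_y f) w.
Proof. exact: tens_liftE. Qed.

Lemma ind_of_poly_zmod_morphism : zmod_morphism ind_of_poly.
Proof. exact: tens_lift_zmod_morphism. Qed.

Lemma ind_of_polyZ a t :
  ind_of_poly (a *: t) = scal (@dahca_relation K n u) a *: ind_of_poly t.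
Proof.
have i0 : ind_of_poly 0 = 0.
  by have := ind_of_poly_zmod_morphism 0 0; rewrite !subrr.
elim/tens_ind: t => [|s t IHs IHt|f w].
- by rewrite i0 !scaler0 i0.
- by rewrite scalerBr !ind_of_poly_zmod_morphism IHs IHt scalerBr.
rewrite -/(ytens f w) scale_ytens !ind_of_polyE eval_yZ scale_ind_tens.
by rewrite /scal -presented_scaleAl mul1r.
Qed.

(* An inverse of [ind_of_poly]; it exists by the PBW property of [dahca]. *)
Record pbw_identification := PBWIdentification {
  poly_of_ind : ind E -> poly_tens;
  ind_of_polyK : cancel ind_of_poly poly_of_ind;
  poly_of_indK : cancel poly_of_ind ind_of_poly
}.

(* The action of [dahca] on K[y] ⊗ W transported from Ind W. *)
Definition circ (P : pbw_identification) (h : dahca n u) (t : poly_tens) :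
  poly_tens := poly_of_ind P (h *: ind_of_poly t).

End Induced.
End Induced.
Export Induced.

(* Main.v *)
From HB Require Import structures.
Require Import Defs.
From mathcomp Require Import all_boot all_algebra all_fingroup.
From mathcomp Require Import reals.
From mathcomp.real_closed Require Import complex.
From mathcomp.multinomials Require Import mpoly.
Import GRing.Theory.
Local Open Scope ring_scope.
Local Open Scope complex_scope.

(** Write [f(y)] for the image of a polynomial [f] in the algebra, [D_ik] for
    the divided difference [(1 - s_ki) / (y_i - y_k)], and
    [t_ik = (1 - c_i c_k) s_ki].  The theorem comes from the commutation formula
      [x_i f(y) = f(y) x_i + u \sum_(k != i) (D_ik f)(y) t_ik]
    ([dx_eval_y]): applied to [1 ⊗ w], its first term vanishes because [f(y) x_i]
    acts through [x_i] on [w], and the factor [t_ik] moves through the tensor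
    sign to act on [w].

    For [f = y_j] the formula is a restatement of the relations between the [x]
    and the [y], since [D_ik y_i = 1], [D_ik y_k = -1], [D_ik y_j = 0] otherwise
    and [c_k c_i = - c_i c_k] ([dunklX]).  It extends to all polynomials since
    both sides obey the Leibniz rule: on the left the commutator with [x_i] is a
    derivation; on the right [D_ik (f g) = (D_ik f) (s_ki g) + f (D_ik g)]
    ([divdiffM]), and the twist by [s_ki] is exactly what moving [t_ik] across
    [g(y)] produces, because the [c] commute with the [y]
    ([clifford_transp_eval_y]).

    This is an equality in the induced module; an inverse of [f ⊗ w |-> f(y) ⊗ w]
    carries it over to [K[y] ⊗ W]. *)

(** * Polynomials *)

(** Identities that are linear in [f] and stable under products reduce to the
    variables; each commutation rule with [f(y)] below is of this kind. *)
Lemma mpoly_alg_ind (K : comNzRingType) (n : nat) (P : {mpoly K[n]} -> Prop) :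
  P 1 -> (forall j, P 'X_j) ->
  (forall f g, P f -> P g -> P (f + g)) -> (forall a f, P f -> P (a *: f)) ->
  (forall f g, P f -> P g -> P (f * g)) ->
  forall f, P f.
Proof.
move=> P1 PX PD PZ PM f.
elim/mpolyind: f => [|a m f _ _ Pf]; first by rewrite -[0](scale0r 1); apply: PZ.
apply: PD => //; apply: PZ; rewrite mpolyXE_id.
apply: (big_ind P) => // j _.
by elim: (m j) => [|d IHd]; rewrite ?expr0 // exprS; apply: PM.
Qed.

Lemma msymX1 (K : comNzRingType) (n : nat) (s : 'S_n) j :
  msym s 'X_j = 'X_(s j) :> {mpoly K[n]}.
Proof. by rewrite /msym mmapX mmap1U. Qed.

(** * Divided differences *)

Section DividedDifference.
Variables (K : comNzRingType) (n : nat).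
Implicit Types (f g q : {mpoly K[n]}) (i k : 'I_n).

(** The coefficients of [y_i - y_k] are 0, 1 and -1, so its leading one is
    1 or -1, hence regular. *)
Lemma lreg_subX i k : i != k -> GRing.lreg ('X_i - 'X_k : {mpoly K[n]}).
Proof.
move=> ik; apply: lreg_mleadc; set p := 'X_i - 'X_k.
have coefp m : p@_m = (U_(i)%MM == m)%:R - (U_(k)%MM == m)%:R.
  by rewrite mcoeffB !mcoeffX.
have : mleadc p != 0.
  rewrite mleadc_eq0; apply/eqP => /(congr1 (mcoeff U_(i))).
  rewrite coefp mcoeff0 eqxx.
  have /negPf-> : (U_(k)%MM : 'X_{1..n}) != U_(i)%MM.
    apply: contraNneq ik => /(congr1 (fun m : 'X_{1..n} => m i)).
    by rewrite !mnm1E eqxx eq_sym; case: eqP.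
  by rewrite subr0 => /eqP; rewrite oner_eq0.
rewrite coefp; do 2!case: (_ == mlead p) => /=.
- by rewrite subrr eqxx.
- by move=> _; rewrite subr0; apply: lreg1.
- by move=> _; rewrite sub0r; apply/lregN/lreg1.
- by rewrite subrr eqxx.
Qed.

(** [divdiff] is a chosen quotient, so its algebra comes from uniqueness of the
    quotient. *)
Lemma divdiff_unique i k f q : k != i ->
  q * ('X_i - 'X_k) = f - msym (tperm k i) f -> divdiff i k f = q.
Proof.
rewrite eq_sym => /lreg_subX reg qE; apply: reg.
by rewrite ![('X_i - _) * _]mulrC divdiffE.
Qed.

Lemma divdiff1 i k : k != i -> divdiff i k (1 : {mpoly K[n]}) = 0.
Proof. by move=> ki; apply: divdiff_unique; rewrite // mul0r msym1 subrr. Qed.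

Lemma divdiffXl i k : k != i -> divdiff i k ('X_i : {mpoly K[n]}) = 1.
Proof. by move=> ki; apply: divdiff_unique; rewrite // mul1r msymX1 tpermR. Qed.

Lemma divdiffXr i k : k != i -> divdiff i k ('X_k : {mpoly K[n]}) = -1.
Proof.
by move=> ki; apply: divdiff_unique; rewrite // mulN1r opprB msymX1 tpermL.
Qed.

Lemma divdiffX_neq i k j : k != i -> j != i -> j != k ->
  divdiff i k ('X_j : {mpoly K[n]}) = 0.
Proof.
move=> ki ji jk; apply: divdiff_unique; rewrite // mul0r msymX1.
by rewrite tpermD ?subrr // eq_sym.
Qed.

Lemma divdiffD i k f g : k != i ->
  divdiff i k (f + g) = divdiff i k f + divdiff i k g.
Proof.
move=> ki; apply: divdiff_unique => //.
by rewrite mulrDl msymD opprD addrACA -!divdiffE.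
Qed.

Lemma divdiffZ i k a f : k != i -> divdiff i k (a *: f) = a *: divdiff i k f.
Proof.
move=> ki; apply: divdiff_unique => //.
by rewrite -scalerAl divdiffE msymZ scalerBr.
Qed.

(** From [f g - s f s g = (f - s f) s g + f (g - s g)]. *)
Lemma divdiffM i k f g : k != i ->
  divdiff i k (f * g) =
  divdiff i k f * msym (tperm k i) g + f * divdiff i k g.
Proof.
move=> ki; apply: divdiff_unique => //.
rewrite mulrDl mulrAC divdiffE -mulrA divdiffE msymM mulrBl mulrBr.
by rewrite addrC addrA subrK.
Qed.

End DividedDifference.

(** * Polynomials in the y_i inside the algebra *)

Section EvalY.
Variables (K : comNzRingType) (n : nat) (u : K).
Implicit Types (f g : {mpoly K[n]}) (m : 'X_{1..n}).
Local Notation H := (dahca n u).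

Lemma dahca_scaleAl a (g h : H) : a *: (g * h) = (a *: g) * h.
Proof. exact: presented_scaleAl. Qed.

Lemma dahca_scaleAr a (g h : H) : a *: (g * h) = g * (a *: h).
Proof. exact: presented_scaleAr. Qed.

Lemma eval_yX m : eval_y u 'X_[m] = \prod_(i < n) (dy u i : H) ^+ m i.
Proof. by rewrite /eval_y msuppX big_seq1 mcoeffX eqxx scale1r. Qed.

Lemma eval_yX1 j : eval_y u 'X_j = dy u j :> H.
Proof.
rewrite eval_yX.
have -> : \prod_(i < n) (dy u i : H) ^+ (U_(j)%MM : 'X_{1..n}) i =
          \prod_(i < n | i == j) (dy u i : H).
  rewrite [RHS]big_mkcond; apply: eq_bigr => i _.
  by rewrite mnm1E eq_sym; case: eqP.
exact: big_pred1_eq.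
Qed.

Lemma eval_y1 : eval_y u (1 : {mpoly K[n]}) = 1.
Proof. by rewrite -mpolyX0 eval_yX big1 // => i _; rewrite mnm0E expr0. Qed.

Lemma eval_y0 : eval_y u (0 : {mpoly K[n]}) = 0.
Proof. by rewrite -(scale0r 0) eval_yZ scale0r. Qed.

Lemma eval_yN f : eval_y u (- f) = - eval_y u f.
Proof. by rewrite -scaleN1r eval_yZ scaleN1r. Qed.

Lemma eval_yM f g : eval_y u (f * g) = eval_y u f * eval_y u g.
Proof.
elim/mpolyind: f => [|a m f _ _ IHf]; first by rewrite mul0r eval_y0 mul0r.
rewrite mulrDl !eval_yD mulrDl IHf {IHf} -scalerAl !eval_yZ -dahca_scaleAl.
congr (_ *: _ + _).
elim/mpolyind: g => [|b p g _ _ IHg]; first by rewrite mulr0 eval_y0 mulr0.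
rewrite mulrDr !eval_yD mulrDr IHg -scalerAr !eval_yZ -dahca_scaleAr.
(* On monomials the factors of equal index are brought together. *)
congr (_ *: _ + _); rewrite -mpolyXD !eval_yX.
elim: (index_enum _) => [|i r IHr]; first by rewrite !big_nil mulr1.
rewrite !big_cons IHr mnmDE exprD -!mulrA; congr (_ * _); rewrite !mulrA.
congr (_ * _); apply: commr_prod => j _; apply/commrX/commr_sym/commrX.
exact: dyy.
Qed.

Lemma ds_eval_y (s : 'S_n) f :
  ds u s * eval_y u f = eval_y u (msym s f) * ds u s.
Proof.
elim/mpoly_alg_ind: f => [|j|f g IHf IHg|a f IHf|f g IHf IHg].
- by rewrite msym1 eval_y1 mulr1 mul1r.
- by rewrite msymX1 !eval_yX1 dsy.
- by rewrite msymD !eval_yD mulrDr mulrDl IHf IHg.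
- by rewrite msymZ !eval_yZ -dahca_scaleAr -dahca_scaleAl IHf.
- by rewrite msymM !eval_yM mulrA IHf -mulrA IHg mulrA.
Qed.

Lemma dc_eval_y k f : dc u k * eval_y u f = eval_y u f * dc u k.
Proof.
elim/mpoly_alg_ind: f => [|j|f g IHf IHg|a f IHf|f g IHf IHg].
- by rewrite eval_y1 mulr1 mul1r.
- rewrite eval_yX1; have [->|jk] := eqVneq j k; first exact: dcy.
  exact: dcy_neq.
- by rewrite !eval_yD mulrDr mulrDl IHf IHg.
- by rewrite !eval_yZ -dahca_scaleAr -dahca_scaleAl IHf.
- by rewrite !eval_yM mulrA IHf -mulrA IHg mulrA.
Qed.

End EvalY.

(** * The commutator of x_i with a polynomial in the y_j *)

Section Commutator.
Variables (K : comNzRingType) (n : nat) (u : K).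
Implicit Types (f g : {mpoly K[n]}) (i k : 'I_n).

Definition clifford_transp i k : dahca n u :=
  (1 - dc u i * dc u k) * ds u (tperm k i).

(** The Clifford factor commutes with polynomials in the [y_j], so only the
    transposition acts on them. *)
Lemma clifford_transp_eval_y i k f :
  clifford_transp i k * eval_y u f =
  eval_y u (msym (tperm k i) f) * clifford_transp i k.
Proof.
rewrite /clifford_transp -mulrA ds_eval_y !mulrA; congr (_ * _).
rewrite mulrBl mulrBr mul1r mulr1; congr (_ - _).
by rewrite -mulrA dc_eval_y !mulrA dc_eval_y.
Qed.

(** The value of the commutator of [x_i] with [f(y)]: a Dunkl operator without
    its derivative term. *)
Definition dunkl i f : dahca n u :=
  u *: \sum_(k | k != i) eval_y u (divdiff i k f) * clifford_transp i k.

Lemma dunkl1 i : dunkl i 1 = 0.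
Proof.
rewrite /dunkl big1 ?scaler0 // => k ki.
by rewrite divdiff1 // eval_y0 mul0r.
Qed.

Lemma dunklD i f g : dunkl i (f + g) = dunkl i f + dunkl i g.
Proof.
rewrite /dunkl -scalerDr; congr (u *: _).
rewrite -big_split; apply: eq_bigr => k ki /=.
by rewrite divdiffD // eval_yD mulrDl.
Qed.

Lemma dunklZ i a f : dunkl i (a *: f) = a *: dunkl i f.
Proof.
rewrite /dunkl [RHS]scalerA [a * u]mulrC -[RHS]scalerA; congr (u *: _).
rewrite scaler_sumr; apply: eq_bigr => k ki.
by rewrite divdiffZ // eval_yZ dahca_scaleAl.
Qed.

(** The twist in the Leibniz rule of divided differences is absorbed by moving
    [clifford_transp] across [g(y)], leaving an untwisted derivation. *)
Lemma dunklM i f g :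
  dunkl i (f * g) = dunkl i f * eval_y u g + eval_y u f * dunkl i g.
Proof.
rewrite /dunkl -dahca_scaleAl -dahca_scaleAr -scalerDr; congr (u *: _).
rewrite mulr_suml mulr_sumr -big_split; apply: eq_bigr => k ki /=.
rewrite divdiffM // eval_yD !eval_yM mulrDl; congr (_ + _).
  by rewrite -[RHS]mulrA clifford_transp_eval_y [RHS]mulrA.
by rewrite [RHS]mulrA.
Qed.

(** For [j = i] every [k] contributes; for [j != i] only [k = j] does. *)
Lemma dunklX i j : dx u i * dy u j - dy u j * dx u i = dunkl i 'X_j.
Proof.
rewrite -opprB /dunkl; have [->|ji] := eqVneq j i.
  rewrite dyx opprK; congr (u *: _); apply: eq_bigr => k ki.
  by rewrite divdiffXl // eval_y1 mul1r /clifford_transp (dcc _ ki).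
rewrite dyx_neq 1?eq_sym // (bigD1 j) //= big1 ?addr0 => [|k /andP[ki kj]].
  rewrite divdiffXr // eval_yN eval_y1 mulN1r.
  by rewrite scalerN /clifford_transp tpermC (dcc _ ji).
by rewrite divdiffX_neq ?eval_y0 ?mul0r // eq_sym.
Qed.

(** Both [x_i f(y) - f(y) x_i] and [dunkl i f] are derivations in [f], and they
    agree on the variables. *)
Lemma dx_eval_y i f :
  dx u i * eval_y u f = eval_y u f * dx u i + dunkl i f.
Proof.
elim/mpoly_alg_ind: f => [|j|f g IHf IHg|a f IHf|f g IHf IHg].
- by rewrite eval_y1 mulr1 mul1r dunkl1 addr0.
- by rewrite eval_yX1 -dunklX addrC subrK.
- by rewrite eval_yD dunklD mulrDr mulrDl IHf IHg addrACA.
- by rewrite eval_yZ dunklZ -dahca_scaleAr IHf scalerDr dahca_scaleAl.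
- by rewrite eval_yM mulrA IHf mulrDl -mulrA IHg mulrDr dunklM !mulrA addrAC addrA.
Qed.

End Commutator.

(** * The action on the induced module *)

Section InducedAction.
Variables (K : comNzRingType) (n : nat) (u : K).
Variables (W : lmodType (clifford_sym K n)) (E : zero_extension u W).
Implicit Types (w : W) (i k : 'I_n) (h : dahca n u).

Lemma ext_actB a b w : ext_act E (a - b) w = ext_act E a w - ext_act E b w.
Proof.
by apply: (addIr (ext_act E b w)); rewrite -(ext_actDl E w) !subrK.
Qed.

Lemma ind_tens0 h : ind_tens E h 0 = 0.
Proof.
by apply: (addrI (ind_tens E h 0)); rewrite {1 2}/ind_tens -tensDr !addr0.
Qed.

Lemma ind_tens_dx h i w : ind_tens E (h * dx u i) w = 0.
Proof.
have -> : dx u i = dahca_x_val (xx u i) by [].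
by rewrite ind_tens_balanced ext_act_x ind_tens0.
Qed.

(** [clifford_transp i k] lies in the subalgebra over which one induces, hence
    can be moved across the tensor sign. *)
Lemma ind_tens_clifford_transp h i k w :
  ind_tens E (h * clifford_transp K n u i k) w =
  ind_tens E h ((1 - cs_c K i * cs_c K k) *: (cs_s K (tperm k i) *: w)).
Proof.
have -> : clifford_transp K n u i k =
    dahca_x_val ((1 - xc u i * xc u k) * xs u (tperm k i)).
  by rewrite rmorphM rmorphB rmorphM rmorph1.
rewrite ind_tens_balanced; congr ind_tens.
rewrite -ext_actA ext_act_s ext_actB ext_act1 -ext_actA !ext_act_c.
by rewrite scalerBl scale1r scalerA.
Qed.

Lemma ind_tensDl w : {morph (ind_tens E)^~ w : g h / g + h}.
Proof. by move=> g h; rewrite /ind_tens tensDl. Qed.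

Lemma ind_tens0l w : ind_tens E 0 w = 0.
Proof. by apply: (addrI (ind_tens E 0 w)); rewrite -ind_tensDl !addr0. Qed.

HB.instance Definition _ := GRing.isZmodMorphism.Build
  (poly_tens W) (ind E) (ind_of_poly E) (ind_of_poly_zmod_morphism E).

Lemma dx_ind_of_poly i (f : {mpoly K[n]}) w :
  dx u i *: ind_of_poly E (ytens f w) =
  ind_of_poly E
    (u *: \sum_(k < n | k != i)
       ytens (divdiff i k f)
         ((1 - cs_c K i * cs_c K k) *: (cs_s K (tperm k i) *: w))).
Proof.
rewrite ind_of_polyZ ind_of_polyE scale_ind_tens dx_eval_y ind_tensDl.
rewrite ind_tens_dx add0r raddf_sum /=.
have -> : dunkl K n u i f = scal (dahca_relation u) u *
    \sum_(k | k != i) eval_y u (divdiff i k f) * clifford_transp K n u i k.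
  by rewrite /scal -presented_scaleAl mul1r.
rewrite -scale_ind_tens; congr (_ *: _).
rewrite (big_morph _ (ind_tensDl w) (ind_tens0l w)).
by apply: eq_bigr => k _; rewrite ind_of_polyE ind_tens_clifford_transp.
Qed.

End InducedAction.

Theorem theorem2p11 (R : realType) (n : nat) (u : R[i])
    (W : lmodType (clifford_sym R[i] n)) (E : zero_extension u W)
    (f : {mpoly R[i][n]}) (w : W) (i : 'I_n) :
  (1 <= n)%N -> u != 0 ->
  let rhs : poly_tens W :=
    u *: \sum_(k < n | k != i)
           ytens (divdiff i k f)
                 ((1 - cs_c R[i] i * cs_c R[i] k) *:
                    (cs_s R[i] (tperm k i) *: w)) in
  (* in Ind W, for the images of both sides under f ⊗ w |-> f ⊗ w *)
  dx u i *: ind_of_poly E (ytens f w) = ind_of_poly E rhs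
  (* in ℂ[y_1, ..., y_n] ⊗ W, identified with Ind W *)
  /\ (forall P : pbw_identification E, circ P (dx u i) (ytens f w) = rhs).
Proof.
move=> _ _ rhs; have xE := dx_ind_of_poly R[i] n u W E i f w.
split=> [|P]; first exact: xE.
by rewrite /circ xE; exact: ind_of_polyK.
Qed.
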